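(* Let $\mathcal{X}\in\mathbb{C}^{m\times m}$ be a solution of the Stein matrix equation $\mathcal{X}=\mathcal{A}\mathcal{X}\mathcal{B}+\mathcal{C}$. Then $F_f(\mathcal{X})$ is a solution of the linear matrix equation $X=Af(X)B+C$, i.e. $F_f(\mathcal{X})=A\,f(F_f(\mathcal{X}))\,B+C$.
   Context: Let $m,n\ge 1$ be integers, $A,B,C\in\mathbb{C}^{m\times m}$, and let $f:\mathbb{C}^{m\times m}\to\mathbb{C}^{m\times m}$ satisfy (1) (''linear'' in the paper's sense) $f(PQ+RS)=f(P)f(Q)+f(R)f(S)$ for all $P,Q,R,S\in\mathbb{C}^{m\times m}$; (2) (period-$n$) $n$ is the least positive integer such that $f^{(n)}(P)=P$ for all $P\in\mathbb{C}^{m\times m}$. Here $f^{(i)}$ is the $i$-fold composition of $f$ with itself, and $f^{(0)}$ is the identity map. For $i\ge 1$ and $X\in\mathbb{C}^{m\times m}$ set $G_i(X)=\Big(\prod_{j=1}^i f^{(j-1)}(A)\Big) f^{(i)}(X)\Big(\prod_{j=1}^i f^{(i-j)}(B)\Big)$, with products ordered from left to right in increasing $j$, i.e. $G_i(X)=A f(A)\cdots f^{(i-1)}(A)\, f^{(i)}(X)\, f^{(i-1)}(B)\cdots f(B)B$; and $G_0(X)=X$. Set $\mathcal{A}=\prod_{i=1}^n f^{(i-1)}(A)=A f(A)\cdots f^{(n-1)}(A)$, $\mathcal{B}=\prod_{i=1}^n f^{(n-i)}(B)=f^{(n-1)}(B)\cdots f(B)B$, and $\mathcal{C}=\sum_{i=1}^{n}G_{i-1}(C)$.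 Define $F_f:\mathbb{C}^{m\times m}\to\mathbb{C}^{m\times m}$ by $F_f(\mathcal{X})=\frac{1}{n}\sum_{i=0}^{n-1}\big(G_i(\mathcal{X})+(n-i-1)G_i(C)\big)$. *)

(* Defs.v *)
From HB Require Import structures.
From mathcomp Require Import all_boot all_order all_algebra.
From mathcomp Require Import reals complex.

Set Implicit Arguments.
Unset Strict Implicit.
Unset Printing Implicit Defensive.

Import GRing.Theory.
Local Open Scope ring_scope.
Local Open Scope complex_scope.

Section Definitions.
Context {R : realType} {m : nat}.
Implicit Types (f : 'M[R[i]]_m -> 'M[R[i]]_m) (A B C X : 'M[R[i]]_m).

(* "Linear" maps here are not the usual linear maps: no compatibility with
   scalars is required (entrywise conjugation qualifies). *)
Definition linear_map f : Prop :=
  forall P Q S T : 'M[R[i]]_m,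
    f (P *m Q + S *m T) = f P *m f Q + f S *m f T.

Definition period (n : nat) f : Prop :=
  [/\ (0 < n)%N,
      (forall P, iter n f P = P) &
      (forall k : nat, (0 < k)%N -> (forall P, iter k f P = P) -> (n <= k)%N)].

(* Matrix multiplication is not commutative: both products are taken from left
   to right in increasing j. *)
Definition stein_G f A B (i : nat) X : 'M[R[i]]_m :=
  (\big[mulmx/1%:M]_(1 <= j < i.+1) iter (j - 1) f A)
    *m iter i f X
    *m (\big[mulmx/1%:M]_(1 <= j < i.+1) iter (i - j) f B).

Lemma stein_G0 f A B X : stein_G f A B 0 X = X.
Proof. by rewrite /stein_G !big_geq // mul1mx mulmx1. Qed.

Definition stein_A (n : nat) f A : 'M[R[i]]_m :=
  \big[mulmx/1%:M]_(1 <= i < n.+1) iter (i - 1) f A.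

Definition stein_B (n : nat) f B : 'M[R[i]]_m :=
  \big[mulmx/1%:M]_(1 <= i < n.+1) iter (n - i) f B.

Definition stein_C (n : nat) f A B C : 'M[R[i]]_m :=
  \sum_(1 <= i < n.+1) stein_G f A B (i - 1) C.

(* The natural number subtraction n - i - 1 is never truncated, as i < n. *)
Definition stein_F (n : nat) f A B C X : 'M[R[i]]_m :=
  n%:R^-1 *: \sum_(0 <= i < n)
    (stein_G f A B i X + (n - i - 1)%:R *: stein_G f A B i C).

End Definitions.

(* Main.v *)
(* A periodic map f satisfying the "linear" identity is a bijective ring
   endomorphism of the matrix algebra, hence also commutes with division by n.
   Consequently X |-> A f(X) B sends G_i(X) to G_{i+1}(X).  Applying it to
   F_f(X) shifts the sum by one index; the Stein equation says
   G_n(X) = X - \sum_(i < n) G_i(C), and the weights n - i - 1 are chosen so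
   that the resulting sums telescope, leaving F_f(X) - C. *)
From HB Require Import structures.
Require Import Defs.
From mathcomp Require Import all_boot all_order all_algebra.
From mathcomp Require Import reals complex.

Set Implicit Arguments.
Unset Strict Implicit.
Unset Printing Implicit Defensive.

Import GRing.Theory Num.Theory.
Local Open Scope ring_scope.
Local Open Scope complex_scope.

(** Allows [big_nat_recr] to split off the last factor of an ordered matrix product. *)
HB.instance Definition _ (R : pzSemiRingType) (m : nat) :=
  Monoid.isLaw.Build 'M[R]_m 1%:M (@mulmx R m m m)
    (@mulmxA R m m m m) (@mul1mx R m m) (@mulmx1 R m m).

Lemma period_surj (R : realType) (m n : nat) (f : 'M[R[i]]_m -> 'M[R[i]]_m) :
  period n f -> forall P, exists Q, f Q = P.
Proof.
case: n => [|n] [] // _ fK _ P.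
by exists (iter n f P); rewrite -iterS.
Qed.

Section SurjectiveLinearMap.
Context {R : realType} {m : nat} (f : 'M[R[i]]_m -> 'M[R[i]]_m).
Hypotheses (f_linear : linear_map f) (f_surj : forall P, exists Q, f Q = P).

(** The identity alone does not force this, since the constant map with value 1/2 times the identity
    matrix satisfies it. A preimage of 0 makes [f 0] square to zero, and then [0 = 0 * 0 + 0 * 0]
    gives the claim. *)
Lemma linear_map0 : f 0 = 0.
Proof.
have f00 : f 0 *m f 0 = 0.
  have [Q fQ0] := f_surj 0.
  have := f_linear 1%:M Q 0 0.
  by rewrite mul1mx mul0mx addr0 fQ0 mulmx0 add0r.
by have := f_linear 0 0 0 0; rewrite mul0mx addr0 f00 addr0.
Qed.

Lemma linear_mapM P Q : f (P *m Q) = f P *m f Q.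
Proof.
by have := f_linear P Q 0 0; rewrite mulmx0 addr0 linear_map0 mul0mx addr0.
Qed.

Lemma linear_map1 : f 1%:M = 1%:M.
Proof.
by have [Q fQ1] := f_surj 1%:M; have := linear_mapM 1%:M Q;
   rewrite mul1mx fQ1 mulmx1.
Qed.

Lemma linear_mapD P Q : f (P + Q) = f P + f Q.
Proof.
by have := f_linear P 1%:M Q 1%:M; rewrite linear_map1 !mulmx1.
Qed.

Lemma linear_map_sum (I : Type) (r : seq I) (F : I -> 'M[R[i]]_m) :
  f (\sum_(i <- r) F i) = \sum_(i <- r) f (F i).
Proof. exact: (big_morph f linear_mapD linear_map0). Qed.

Lemma linear_map_prod (I : Type) (r : seq I) (F : I -> 'M[R[i]]_m) :
  f (\big[mulmx/1%:M]_(i <- r) F i) = \big[mulmx/1%:M]_(i <- r) f (F i).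
Proof. exact: (big_morph f linear_mapM linear_map1). Qed.

Lemma linear_mapZnat k P : f (k%:R *: P) = k%:R *: f P.
Proof.
rewrite !scaler_nat; elim: k => [|k IHk]; first exact: linear_map0.
by rewrite !mulrS linear_mapD IHk.
Qed.

(** Since [f] need not respect scalars, both sides are multiplied by [k], which passes through [f]
    by additivity and cancels in characteristic 0. *)
Lemma linear_mapZinvnat k P : (0 < k)%N -> f (k%:R^-1 *: P) = k%:R^-1 *: f P.
Proof.
move=> k_gt0; have k_neq0 : k%:R != 0 :> R[i] by rewrite pnatr_eq0 -lt0n.
apply: (scalerI k_neq0).
by rewrite -linear_mapZnat !scalerA divff // !scale1r.
Qed.

(** Applying [f] raises every iterate by one; the missing zeroth iterates are [A], the leftmost
    factor, and [B], the rightmost one. *)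
Lemma stein_GS A B i X :
  stein_G f A B i.+1 X = A *m f (stein_G f A B i X) *m B.
Proof.
have prodA : \big[mulmx/1%:M]_(1 <= j < i.+2) iter (j - 1) f A =
    A *m f (\big[mulmx/1%:M]_(1 <= j < i.+1) iter (j - 1) f A).
  rewrite linear_map_prod big_ltn // [in LHS]big_add1; congr (_ *m _).
  by apply: eq_big_nat => -[|j] // _; rewrite !subn1.
have prodB : \big[mulmx/1%:M]_(1 <= j < i.+2) iter (i.+1 - j) f B =
    f (\big[mulmx/1%:M]_(1 <= j < i.+1) iter (i - j) f B) *m B.
  rewrite linear_map_prod big_nat_recr // subnn; congr (_ *m _).
  by apply: eq_big_nat => j /andP[_ j_le_i]; rewrite subSn.
by rewrite /stein_G prodA prodB iterS !linear_mapM !mulmxA.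
Qed.

End SurjectiveLinearMap.

Lemma stein_G_period (R : realType) (m n : nat) (A B X : 'M[R[i]]_m)
    (f : 'M[R[i]]_m -> 'M[R[i]]_m) :
  period n f -> stein_G f A B n X = stein_A n f A *m X *m stein_B n f B.
Proof. by case=> _ fK _; rewrite /stein_G fK. Qed.

Lemma stein_CE (R : realType) (m n : nat) (A B C : 'M[R[i]]_m)
    (f : 'M[R[i]]_m -> 'M[R[i]]_m) :
  stein_C n f A B C = \sum_(0 <= i < n) stein_G f A B i C.
Proof.
by rewrite /stein_C big_add1; apply: eq_bigr => i _; rewrite subSS subn0.
Qed.

Lemma sum_shift (V : zmodType) (n : nat) (g : nat -> V) :
  \sum_(0 <= i < n) g i.+1 = \sum_(0 <= i < n) g i + g n - g 0%N.
Proof. by rewrite -big_nat_recr // big_nat_recl //= addrAC subrr add0r. Qed.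

Theorem theorem2p1 (R : realType) (m n : nat) (hm : (0 < m)%N) (hn : (0 < n)%N)
    (A B C : 'M[R[i]]_m) (f : 'M[R[i]]_m -> 'M[R[i]]_m)
    (f_linear : linear_map f) (f_period : period n f)
    (X : 'M[R[i]]_m)
    (hX : X = stein_A n f A *m X *m stein_B n f B + stein_C n f A B C) :
  stein_F n f A B C X = A *m f (stein_F n f A B C X) *m B + C.
Proof.
have f_surj := period_surj f_period.
have n_neq0 : n%:R != 0 :> R[i] by rewrite pnatr_eq0 -lt0n.
have GnX : stein_G f A B n X = X - \sum_(0 <= i < n) stein_G f A B i C.
  by rewrite (stein_G_period _ _ _ f_period) -stein_CE {2}hX addrK.
rewrite /stein_F linear_mapZinvnat // -scalemxAr -scalemxAl.
apply: (scalerI n_neq0); rewrite scalerDr !scalerA divff // !scale1r.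
rewrite linear_map_sum // mulmx_sumr mulmx_suml.
(* Writing the weight as [n - i.+1] makes the whole summand a function of [i.+1], the form required
   by [sum_shift]. *)
under [in RHS]eq_bigr => i _.
  rewrite linear_mapD // linear_mapZnat // mulmxDr mulmxDl.
  rewrite -scalemxAr -scalemxAl -!(stein_GS f_linear f_surj) -subnDA addn1.
  over.
rewrite !big_split /= (sum_shift n (fun i => stein_G f A B i X)) GnX.
(* The boundary term at [n] has weight 0; the one at 0 is [n%:R *: C], which cancels the constant
   term. *)
rewrite (sum_shift n (fun i => (n - i)%:R *: stein_G f A B i C)).
rewrite subnn scale0r addr0 subn0 !stein_G0.
(* Lowering each weight by one, without truncation as [i < n], releases exactly the sum subtracted
   in [GnX]. *)
have -> : \sum_(0 <= i < n) (n - i)%:R *: stein_G f A B i C =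
    \sum_(0 <= i < n) (n - i - 1)%:R *: stein_G f A B i C
    + \sum_(0 <= i < n) stein_G f A B i C.
  rewrite -big_split; apply: eq_big_nat => i /andP[_ lt_in] /=.
  rewrite -[X in _ + X]scale1r -scalerDl natr1.
  by rewrite -subnDA addn1 subnSK.
rewrite -[RHS]addrA subrK [_ + (X - _)]addrA [_ + X - _]addrAC addrK.
by rewrite addrACA addNr addr0.
Qed.
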